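(* There is a polynomial $p$ such that for every $n\ge 2$ and every choice of guard functions $r,s$ (as in the context), the guarded graph tautology formula $\mathrm{GGT}_n$ has a tree-like regular resolution refutation with input lemmas (a regRTI refutation) with at most $p(n)$ clauses.
   Context: Clauses are sets of literals (disjunctions); a resolution inference derives $A'\lor B'$ from $A'\lor x$ and $B'\lor \overline{x}$ (with $\overline x\notin A'$, $x\notin B'$), resolving on $x$. A pool resolution (regRTL) refutation of a set $F$ of clauses is a finite binary tree $T$ of clauses such that: the root is the empty clause; each internal node is obtained by resolution from its two children; each leaf is either a clause of $F$ or a clause (''lemma'') labeling a node occurring earlier in the postorder of $T$ (postorder: for a node $u$, every node $v$ in the left subtree and every node $w$ in the right subtree satisfy $v<w<u$); and along every root-to-leaf path each variable is resolved on at most once. A regRTI refutation is a pool resolution refutation in which every lemma used at a leaf is an input lemma: it is the conclusion of an earlier subderivation of $T$ that is an input derivation, i.e. each inference in that subderivation has at least one hypothesis that is a member of $F$ or a lemma. Graph tautology variables: for $[n]=\{0,\dots,n-1\}$ there are variables $x_{i,j}$ for $i<j$, and for $i>j$, $x_{i,j}$ denotes $\overline x_{j,i}$. For distinct $i,j,k$, $T_{i,j,k}:=\overline x_{i,j}\lor\overline x_{j,k}\lor\overline x_{k,i}$. Let $r,s:[n]^3\to[n]$ satisfy, for distinct $i,j,k$: $r(i,j,k)\ne s(i,j,k)$, $\{r(i,j,k),s(i,j,k)\}\not\subseteq\{i,j,k\}$, and invariance under cyclic rotation of $(i,j,k)$. $\mathrm{GGT}_n$ consists of the clauses $\bigvee_{j\ne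 i}x_{j,i}$ for each $i\in[n]$, and for all distinct $i,j,k$ (with $r=r(i,j,k)$, $s=s(i,j,k)$) the clauses $T_{i,j,k}\lor x_{r,s}$ and $T_{i,j,k}\lor \overline x_{r,s}$. *)

(* Defs.v *)
From HB Require Import structures.
From mathcomp Require Import all_boot all_order all_algebra.

Set Implicit Arguments.
Unset Strict Implicit.
Unset Printing Implicit Defensive.

Section Resolution.

Variable V : finType.

(* (v, true) is the variable v, (v, false) its negation. *)
Definition literal : Type := V * bool.
Definition clause : Type := {set V * bool}.
Definition formula : Type := {set {set V * bool}}.

Definition neg (l : literal) : literal := (l.1, ~~ l.2).

(* Here A = A' \/ l and B = B' \/ neg l, where A' = A :\ l and
   B' = B :\ neg l.  Since l is a literal, either of the two premises may
   be the one containing the resolved variable positively. *)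
Definition resolvent (l : literal) (A B C : clause) : bool :=
  [&& l \in A, neg l \notin A, neg l \in B, l \notin B
    & C == (A :\ l) :|: (B :\ neg l)].

(* In [Node C l t1 t2], C labels the node and l is the literal resolved on. *)
Inductive rtree : Type :=
| Leaf of clause
| Node of clause & literal & rtree & rtree.

Definition conclusion (t : rtree) : clause :=
  match t with Leaf C => C | Node C _ _ _ => C end.

Definition is_leaf (t : rtree) : bool :=
  if t is Leaf _ then true else false.

(* The nodes of t in postorder, each given as the subtree rooted there. *)
Fixpoint postorder (t : rtree) : seq rtree :=
  match t with
  | Leaf _ => [:: t]
  | Node _ _ t1 t2 => postorder t1 ++ postorder t2 ++ [:: t]
  end.

(* One clause per node: clauses occurring repeatedly are counted repeatedly. *)
Definition num_clauses (t : rtree) : nat := size (postorder t).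

Definition inference_ok (t : rtree) : bool :=
  match t with
  | Leaf _ => true
  | Node C l t1 t2 => resolvent l (conclusion t1) (conclusion t2) C
  end.

(* For each root-to-leaf path, the variables resolved on along it. *)
Fixpoint path_vars (t : rtree) : seq (seq V) :=
  match t with
  | Leaf _ => [:: [::]]
  | Node _ l t1 t2 => [seq l.1 :: p | p <- path_vars t1 ++ path_vars t2]
  end.

Definition regular (t : rtree) : bool := all uniq (path_vars t).

(* The hypotheses of an inference that are members of the refuted formula or
   lemmas are its children that are leaves of the tree. *)
Definition input_inference (t : rtree) : bool :=
  match t with
  | Leaf _ => true
  | Node _ _ t1 t2 => is_leaf t1 || is_leaf t2
  end.

Definition input_derivation (t : rtree) : bool :=
  all input_inference (postorder t).

(* Each leaf is in F or is a lemma, i.e. the conclusion of a subtree that comes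
   strictly earlier in postorder; this subtree is required to satisfy P. *)
Definition leaves_ok (F : formula) (P : rtree -> bool) (t : rtree) : Prop :=
  let node := nth (Leaf set0) (postorder t) in
  forall (i : nat) (C : clause), i < size (postorder t) -> node i = Leaf C ->
    C \in F \/ exists2 j, j < i & P (node j) /\ conclusion (node j) = C.

Definition pool_refutation (F : formula) (t : rtree) : Prop :=
  [/\ conclusion t = set0,
      all inference_ok (postorder t),
      leaves_ok F xpredT t
    & regular t].

Definition regRTI_refutation (F : formula) (t : rtree) : Prop :=
  pool_refutation F t /\ leaves_ok F input_derivation t.

End Resolution.

Section GuardedGraphTautology.

Variable n : nat.

(* The variable x_{i,j}, i < j, is the pair (i, j); the pairs (i, j) with
   j <= i occur in no clause of GGT, hence in no derivation from it. *)
Definition gvar : finType := ('I_n * 'I_n)%type.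

(* Only meant for distinct i and j. *)
Definition x (i j : 'I_n) : literal gvar :=
  if i < j then ((i, j), true) else ((j, i), false).

Definition T3 (i j k : 'I_n) : clause gvar :=
  [set neg (x i j); neg (x j k); neg (x k i)].

Definition has_pred (i : 'I_n) : clause gvar := [set x j i | j : 'I_n & j != i].

Variables r s : 'I_n -> 'I_n -> 'I_n -> 'I_n.

Definition guards : Prop :=
  forall i j k : 'I_n, uniq [:: i; j; k] ->
    [/\ r i j k != s i j k,
        ~~ ([set r i j k; s i j k] \subset [set i; j; k]),
        r j k i = r i j k
      & s j k i = s i j k].

Definition GGT : formula gvar :=
  [set C | [exists i, C == has_pred i]
        || [exists i, exists j, exists k,
             uniq [:: i; j; k] &&
             ((C == x (r i j k) (s i j k) |: T3 i j k)
              || (C == neg (x (r i j k) (s i j k)) |: T3 i j k))]].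

End GuardedGraphTautology.

(* Main.v *)
Require Import Defs.
From HB Require Import structures.
From mathcomp Require Import all_boot all_order all_algebra.
From mathcomp Require Import zify.

Set Implicit Arguments.
Unset Strict Implicit.
Unset Printing Implicit Defensive.

(* The refutation is found by a depth-first search.  A node is given by a clause
   Γ, the negation of the assignment on the path to it.  The clause derived at
   the node lies within Γ, is derived without resolving on variables of Γ, and
   contains every literal of Γ saying that some element lies above a Γ-minimal
   one.  The search branches on two minimal elements, or on a minimal and a
   non-minimal one, so that each resolved literal is known to occur in its
   premise and no weakening is needed.

   If some clause T_{a,b,c} that the refutation below Γ needs is neither a lemma
   nor obtainable from an initial clause whose guard literal lies in Γ, then at
   most three branchings lead to a leaf falsifying it; there the guard variable
   is unset, so resolving on it makes T_{a,b,c} an input lemma.  This happens at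
   most n^3 times, each time leaving at most three further goals.

   Once all needed clauses are available, the minimal elements are eliminated as
   in the usual refutation of the graph tautology: with the minimal elements
   numbered, D_{a,m} (a has a predecessor numbered below m) follows from
   D_{a,m+1} and D_{c,m+1}, where c is number m, through the clause Q_{a,c}
   (x_{c,a} implies D_{a,m}).  The Q_{a,c} become input lemmas, and any D_{c,m}
   needed again is rederived from them by an input derivation. *)

(** * Derivations with input lemmas *)

Section Derivations.

Variables (V : finType) (F : formula V).
Implicit Types (t u : rtree V) (L : {set clause V}) (U : {set V}) (C : clause V).

Fixpoint vars t : {set V} :=
  if t is Node _ l t1 t2 then l.1 |: (vars t1 :|: vars t2) else set0.

Definition learned t : {set clause V} :=
  [set C in [seq conclusion u | u <- postorder t & input_derivation u]].

(** The refutation conditions in recursive form: [L] holds the lemmas gained earlier in the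
    postorder, and the right subtree may also use those of the left one. *)
Fixpoint valid L t : bool :=
  match t with
  | Leaf C => C \in F :|: L
  | Node C l t1 t2 =>
      [&& valid L t1, valid (L :|: learned t1) t2,
          resolvent l (conclusion t1) (conclusion t2) C
        & l.1 \notin vars t1 :|: vars t2]
  end.

Lemma learned_node C l t1 t2 :
  learned t1 :|: learned t2 \subset learned (Node C l t1 t2).
Proof.
apply/subsetP=> D; rewrite !inE /= !filter_cat !map_cat !mem_cat.
by case/orP=> ->; rewrite ?orbT.
Qed.

Lemma conclusion_learned t : input_derivation t -> conclusion t \in learned t.
Proof.
move=> it; rewrite inE; case: t it => [C|C l t1 t2] it //=.
  by rewrite inE.
by rewrite !filter_cat !map_cat !mem_cat /= it /= mem_head !orbT.
Qed.

Lemma sub_valid L L' t : L \subset L' -> valid L t -> valid L' t.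
Proof.
elim: t L L' => [C|C l t1 IH1 t2 IH2] L L' sub /=.
  by rewrite !inE => /orP[->//|/(subsetP sub)->]; rewrite orbT.
case/and4P=> v1 v2 -> ->; rewrite (IH1 _ _ sub v1) (IH2 _ _ _ v2) //.
exact: setSU.
Qed.

Lemma valid_inference_ok L t : valid L t -> all (@inference_ok V) (postorder t).
Proof.
elim: t L => //= C l t1 IH1 t2 IH2 L /and4P[/IH1 v1 /IH2 v2 res _].
by rewrite !all_cat v1 v2 /= res.
Qed.

Lemma path_vars_sub t p : p \in path_vars t -> {subset p <= vars t}.
Proof.
elim: t p => [C|C l t1 IH1 t2 IH2] p /=; first by rewrite inE => /eqP->.
case/mapP=> q + -> v; rewrite mem_cat !inE.
by case/orP=> [/IH1|/IH2] sub /orP[->//|/sub->]; rewrite ?orbT.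
Qed.

Lemma valid_regular L t : valid L t -> regular t.
Proof.
rewrite /regular; elim: t L => //= C l t1 IH1 t2 IH2 L /and4P[/IH1 v1 /IH2 v2 _].
rewrite inE => nl; apply/allP => _ /mapP[q qin ->] /=; move: nl.
rewrite negb_or => /andP[n1 n2].
move: qin; rewrite mem_cat => /orP[] qin; apply/andP; split.
- by apply: contra n1; apply: path_vars_sub.
- exact: (allP v1).
- by apply: contra n2; apply: path_vars_sub.
- exact: (allP v2).
Qed.

(** * From valid trees to regRTI refutations *)

Definition has_lemma (s : seq (rtree V)) C :=
  has (fun u => input_derivation u && (conclusion u == C)) s.

Lemma learned_has_lemma t C : C \in learned t -> has_lemma (postorder t) C.
Proof.
rewrite inE /has_lemma; elim: (postorder t) => //= u s IH.
case: (input_derivation u) => //=; rewrite inE eq_sym.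
by case/orP=> [->//|/IH->]; rewrite orbT.
Qed.

(** Here [pre] stands for the nodes before [t] in a larger tree; the induction enters the right
    subtree by appending the left postorder to it. *)
Lemma valid_leaf_has_lemma L t (pre : seq (rtree V)) :
  valid L t -> (forall C, C \in L -> C \in F \/ has_lemma pre C) ->
  forall i C, i < size (postorder t) ->
    nth (Leaf set0) (postorder t) i = Leaf C ->
    C \in F \/ has_lemma (pre ++ take i (postorder t)) C.
Proof.
elim: t L pre => [C|C l t1 IH1 t2 IH2] L pre /=.
  rewrite inE => vC Lpre [|//] D _ [<-]; rewrite cats0.
  by case/orP: vC => [|/Lpre]; [left|].
case/and4P=> v1 v2 _ _ Lpre i D.
rewrite !size_cat /= nth_cat take_cat => ilt.
case: ltnP => [i1|i1]; first exact: IH1 v1 Lpre i D i1.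
rewrite nth_cat take_cat; case: ltnP => [i2|i2]; last first.
  (* Only the index of the root remains, and the root is not a leaf. *)
  have -> : i - size (postorder t1) - size (postorder t2) = 0 by clear -i1 i2 ilt; lia.
  by [].
rewrite catA; apply: IH2 v2 _ _ _ i2 => E; rewrite inE => /orP[/Lpre[]|/learned_has_lemma h].
- by left.
- by right; rewrite /has_lemma has_cat -/(has_lemma _ _) b.
- by right; rewrite /has_lemma has_cat -/(has_lemma (postorder t1) E) h orbT.
Qed.

Lemma valid_regRTI t :
  valid set0 t -> conclusion t = set0 -> regRTI_refutation F t.
Proof.
move=> v c; have lemmas : leaves_ok F (@input_derivation V) t.
  move=> /= i C ilt Ci.
  have [D|CF|/(has_nthP (Leaf set0))[j]] := valid_leaf_has_lemma (pre := [::]) v _ ilt Ci.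
  - by rewrite inE.
  - by left.
  rewrite size_take ilt => ji; rewrite nth_take // => /andP[ij /eqP cj].
  by right; exists j.
split=> //; split=> //; [exact: valid_inference_ok v| |exact: valid_regular v].
move=> /= i C ilt Ci; case: (lemmas i C ilt Ci) => [|[j ji [_ cj]]]; first by left.
by right; exists j.
Qed.

(* [der b L U C L' k]: with the lemmas of L at hand, C has a derivation (an
   input derivation if b) with at most k nodes, resolving on variables of U
   only, after which the lemmas of L' are available. *)
Definition der (b : bool) L U C L' (k : nat) : Prop :=
  exists t, [/\ valid L t, conclusion t = C, vars t \subset U,
    (L \subset L') && (L' \subset L :|: learned t)
    & (num_clauses t <= k) && (b ==> input_derivation t)].

Lemma der_weaken b L U C L' k b' U' k' :
  (b' ==> b) -> U \subset U' -> k <= k' -> der b L U C L' k -> der b' L U' C L' k'.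
Proof.
move=> bb UU kk [t [v c vU LL /andP[tk bt]]]; exists t; split=> //.
  exact: subset_trans UU.
rewrite (leq_trans tk kk) /=; apply/implyP=> b'T.
by rewrite b'T in bb; exact: implyP bt bb.
Qed.

Lemma der_mono b L U C L' k : der b L U C L' k -> L \subset L'.
Proof. by case=> t [_ _ _ /andP[]]. Qed.

Lemma der_leaf b L C : C \in F :|: L -> der b L set0 C L 1.
Proof.
move=> CF; exists (Leaf C); split=> //=; first by rewrite subxx subsetUl.
by rewrite /input_derivation /= implybT.
Qed.

Lemma der_learn L U C L' k : der true L U C L' k -> der true L U C (C |: L') k.
Proof.
case=> t [v c vU /andP[LL LL'] /andP[tk it]]; exists t; split=> //; last by rewrite tk it.
rewrite (subset_trans LL (subsetUr _ _)) /= subUset LL' andbT sub1set inE -c.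
by rewrite conclusion_learned ?orbT.
Qed.

(** Lemmas gained on the left are passed on to the right. Both premises may be inner nodes, hence
    the flag [false]. *)
Lemma der_resolve b1 b2 L L1 L2 U C1 C2 C l k1 k2 :
  der b1 L U C1 L1 k1 -> der b2 L1 U C2 L2 k2 ->
  l.1 \notin U -> resolvent l C1 C2 C ->
  der false L (l.1 |: U) C L2 (k1 + k2 + 1).
Proof.
case=> t1 [v1 c1 U1 /andP[s1 s1'] /andP[n1 i1]].
case=> t2 [v2 c2 U2 /andP[s2 s2'] /andP[n2 i2]] lU res.
exists (Node C l t1 t2); split=> //=.
- rewrite v1 c1 c2 res (sub_valid s1' v2) /= inE negb_or.
  by rewrite !(contra _ lU) //; apply: subsetP.
- by rewrite setUS // subUset U1 U2.
- rewrite (subset_trans s1 s2) /=; apply: (subset_trans s2').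
  apply: (@subset_trans _ _ (L :|: (learned t1 :|: learned t2))); last first.
    by rewrite setUS // learned_node.
  by rewrite setUA setSU.
- rewrite /num_clauses /= !size_cat /= andbT.
  by rewrite addnA leq_add // leq_add.
Qed.

(** A leaf as right premise keeps an input derivation input; coming after the left subtree, it may
    cite any lemma gained there. *)
Lemma der_resolve_leaf b L L1 U C1 A C l k :
  der b L U C1 L1 k -> A \in F :|: L1 ->
  l.1 \notin U -> resolvent l C1 A C ->
  der b L (l.1 |: U) C L1 (k + 2).
Proof.
case=> t1 [v1 c1 U1 /andP[s1 s1'] /andP[n1 i1]] AF lU res.
exists (Node C l t1 (Leaf A)); split=> //=.
- rewrite v1 c1 res /= setU0 (contra _ lU) ?andbT /=; last exact: subsetP.
  move: AF; rewrite !inE => /orP[->//|/(subsetP s1')].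
  by rewrite !inE => ->; rewrite orbT.
- by rewrite setUS // setU0.
- rewrite s1 /=; apply: (subset_trans s1'); rewrite setUS //.
  exact: subset_trans (subsetUl _ _) (learned_node _ _ _ _).
- rewrite /num_clauses /= !size_cat /=; apply/andP; split.
    by rewrite leq_add.
  apply/implyP=> bT; move: i1; rewrite bT /= /input_derivation /= !all_cat /= => ->.
  by rewrite orbT.
Qed.

Lemma resolventI l (A B : clause V) :
  l \in A -> neg l \notin A -> neg l \in B -> l \notin B ->
  resolvent l A B ((A :\ l) :|: (B :\ neg l)).
Proof. by rewrite /resolvent => -> -> -> -> /=. Qed.

(** No [A j] mentions the variable of another [y i], so a resolution step leaves the remaining
    pivots untouched. Each step adds a leaf and an inference, whence the factor 2. *)
Lemma der_chain (I : eqType) (K : seq I) (y : I -> literal V) (A : I -> clause V)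
    b L U C0 L0 k :
  der b L U C0 L0 k ->
  uniq [seq (y i).1 | i <- K] ->
  (forall i, i \in K -> [/\ (y i).1 \notin U, y i \in C0 & neg (y i) \notin C0]) ->
  (forall i, i \in K ->
     [/\ A i \in F :|: L0, neg (y i) \in A i & y i \notin A i]) ->
  (forall i j, i \in K -> j \in K -> i != j ->
     (y i \notin A j) && (neg (y i) \notin A j)) ->
  der b L (U :|: [set v in [seq (y i).1 | i <- K]])
    ((C0 :\: [set l in map y K]) :|: \bigcup_(i <- K) (A i :\ neg (y i)))
    L0 (k + 2 * size K).
Proof.
elim: K U C0 k => [|i K IH] U C0 k d0 /=.
  move=> _ _ _ _; rewrite big_nil setU0 muln0 addn0.
  have -> : C0 :\: [set l : literal V in [::]] = C0.
    by apply/setP=> z; rewrite !inE.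
  by apply: der_weaken d0 => //; [case: b|exact: subsetUl].
case/andP=> iK uK hK hF hA.
have [iU iC0 niC0] := hK i (mem_head _ _).
have [AiF niA iA] := hF i (mem_head _ _).
have d1 := der_resolve_leaf d0 AiF iU (resolventI iC0 niC0 niA iA).
have neqv j : j \in K -> ((y j).1 != (y i).1) && (j != i).
  move=> jK; have neq : (y j).1 != (y i).1.
    by apply: contraNneq iK => <-; apply: map_f.
  by rewrite neq; apply: contraNneq neq => ->.
have := IH _ _ _ d1 uK; rewrite big_cons.
case.
- move=> j jK; have [jU jC0 njC0] := hK j (mem_behead (s := i :: K) jK).
  have /andP[jiv ji] := neqv j jK.
  have jiy : y j != y i by apply: contraNneq jiv => ->.
  have /andP[jAi njAi] := hA j i (mem_behead (s := i :: K) jK) (mem_head _ _) ji.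
  split=> //; rewrite !inE ?negb_or ?jiv ?jU ?jiy ?jC0 //.
  by rewrite (negPf njC0) (negPf njAi) !andbF.
- by move=> j jK; apply: hF; rewrite inE jK orbT.
- by move=> j j' jK jK'; apply: hA; rewrite inE ?jK ?jK' orbT.
move=> t [v c vU LL tk]; exists t; split=> //.
- rewrite c; apply/setP=> z; rewrite !inE.
  have [-> /=|zi /=] := eqVneq z (y i).
    case: mapP => [[j jK eij]|_] /=; last by rewrite (negPf iA) /= !andbF.
    by have /andP[] := neqv j jK; rewrite eij eqxx.
  case: mapP => [[j jK ->]|_] /=; last by rewrite -orbA.
  have /andP[/negPf-> _] := hA j i (mem_behead (s := i :: K) jK) (mem_head _ _)
    (proj2 (andP (neqv j jK))).
  by rewrite !andbF.
- apply: subset_trans vU _; apply/subsetP=> w; rewrite !inE.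
  by case/orP=> [/orP[]|] ->; rewrite ?orbT.
- by move/andP: tk => [tk ->]; rewrite andbT; clear -tk; lia.
Qed.

End Derivations.

(** * Order literals and transitivity clauses *)

Definition clause_vars (V : finType) (C : clause V) : {set V} := [set l.1 | l in C].

Lemma mem_clause_vars (V : finType) (C : clause V) (l : literal V) :
  (l.1 \in clause_vars C) = (l \in C) || (neg l \in C).
Proof.
apply/imsetP/orP=> [[[w c] wC]|[lC|lC]].
- by case: l => v b /= ->; case: b; case: c wC => wC; [left|right|right|left].
- by exists l.
- by exists (neg l).
Qed.

Ltac x_contra :=
  repeat match goal with
  | H : is_true (_ || _) |- _ => case/orP: H => H
  | H : is_true (_ && _) |- _ =>
      let H1 := fresh in let H2 := fresh in case/andP: H => H1 H2
  | H : is_true (_ == _) |- _ => move/eqP: H => H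
  | H : is_true (_ != _) |- _ => move/eqP: H => H
  | H : is_true (~~ _) |- _ => move/negPf: H => H
  | H : is_true ?b |- _ => change (b = true) in H
  end;
  first [congruence
    | match goal with
      | H : ?a = true, H' : ?b = false |- _ =>
          by rewrite H in H'
      end].

Lemma uniq3 (T : eqType) (a b c : T) :
  uniq [:: a; b; c] = [&& a != b, a != c & b != c].
Proof. by rewrite /= !inE negb_or andbT andbA. Qed.

Section Order.

Variable n : nat.
Implicit Types (a b c d i j k : 'I_n) (C D Γ : clause (gvar n)).
Implicit Types (L : {set clause (gvar n)}).

(** The sign tells in which order the variable lists the two indices, so [x] is injective even on
    the diagonal. *)
Lemma x_eqE a b c d : (x a b == x c d) = (a == c) && (b == d).
Proof.
apply/eqP/andP=> [|[/eqP-> /eqP->] //]; rewrite /x.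
by case: ifP => _; case: ifP => _ //= [-> ->]; rewrite !eqxx.
Qed.

Lemma neg_x a b : a != b -> neg (x a b) = x b a.
Proof.
move=> ab; rewrite /neg /x; case: ltngtP => //= /val_inj abE.
by rewrite abE eqxx in ab.
Qed.

Lemma mem_T3 a b c (l : literal (gvar n)) : uniq [:: a; b; c] ->
  (l \in T3 a b c) = [|| l == x b a, l == x c b | l == x a c].
Proof.
rewrite uniq3 => /and3P[ab ac bc].
by rewrite !inE !neg_x 1?(eq_sym c) // orbA.
Qed.

(* A clause Γ stands for the falsifying assignment: [x a b \in Γ] says that b
   precedes a. *)
Definition minimal Γ : {set 'I_n} := [set a | [forall b, x a b \notin Γ]].

Definition from_minimal Γ : clause (gvar n) :=
  [set l in Γ | [exists c in minimal Γ, exists k, l == x k c]].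

Lemma minimalP Γ a : reflect (forall b, x a b \notin Γ) (a \in minimal Γ).
Proof. by rewrite inE; apply: forallP. Qed.

Lemma mem_from_minimal Γ k c :
  (x k c \in from_minimal Γ) = (x k c \in Γ) && (c \in minimal Γ).
Proof.
rewrite [in LHS]inE; congr (_ && _); apply/existsP/idP=> [[d /andP[dM /existsP[j]]]|cM].
  by rewrite x_eqE => /andP[_ /eqP->].
by exists c; rewrite cM; apply/existsP; exists k.
Qed.

(** * Guards and available transitivity clauses *)

Variables r s : 'I_n -> 'I_n -> 'I_n -> 'I_n.

Definition guard a b c := x (r a b c) (s a b c).

Definition available L Γ a b c :=
  (T3 a b c \in L) || ((guard a b c).1 \in clause_vars Γ).

(* A clause that is at hand and agrees with [T3 a b c] up to literals of Γ. *)
Definition available_clause L Γ a b c :=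
  if T3 a b c \in L then T3 a b c
  else if guard a b c \in Γ then guard a b c |: T3 a b c
  else neg (guard a b c) |: T3 a b c.

Lemma has_pred_GGT a : has_pred a \in GGT r s.
Proof. by rewrite inE; apply/orP; left; apply/existsP; exists a. Qed.

Lemma T3_GGT a b c : uniq [:: a; b; c] ->
  (guard a b c |: T3 a b c \in GGT r s) &&
  (neg (guard a b c) |: T3 a b c \in GGT r s).
Proof.
move=> u; rewrite !inE; apply/andP; split; apply/orP; right;
  apply/existsP; exists a; apply/existsP; exists b; apply/existsP; exists c;
  by rewrite u eqxx ?orbT.
Qed.

Lemma available_clause_in L L' Γ a b c : uniq [:: a; b; c] -> L \subset L' ->
  available_clause L Γ a b c \in GGT r s :|: L'.
Proof.
move=> u LL; have /andP[g1 g2] := T3_GGT u; rewrite in_setU /available_clause.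
case: ifP => [/(subsetP LL)->|_]; first by rewrite orbT.
by case: ifP => _; rewrite ?g1 ?g2.
Qed.

Lemma T3_available L Γ a b c : T3 a b c \subset available_clause L Γ a b c.
Proof.
rewrite /available_clause; case: ifP => _ //.
by case: ifP => _; apply: subsetUr.
Qed.

Lemma available_sub L Γ a b c : available L Γ a b c ->
  available_clause L Γ a b c \subset T3 a b c :|: Γ.
Proof.
rewrite /available /available_clause mem_clause_vars.
case: ifP => _ /=; first by rewrite subsetUl.
by case: ifP => /= [g _|_ g]; rewrite subUset subsetUl sub1set inE g orbT.
Qed.

End Order.

(** * Eliminating the minimal elements *)

Section Elimination.

Variables (n : nat) (r s : 'I_n -> 'I_n -> 'I_n -> 'I_n).
Variables (L : {set clause (gvar n)}) (Γ : clause (gvar n)).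
Let M := minimal Γ.

Hypothesis above : forall k, k \notin M -> exists2 a, a \in M & x k a \in Γ.
(** The elimination uses two kinds of triple: three minimal elements, and a [b] lying above [a] but
    not above [c]. *)
Hypothesis avail : forall a b c, a \in M -> c \in M -> uniq [:: a; b; c] ->
  (b \in M) || (x b a \in Γ) -> x b c \notin Γ -> available r s L Γ a b c.

Implicit Types (a b c d i j k : 'I_n) (C D : clause (gvar n)).

Let F := GGT r s.

(** * Numbering of the minimal elements *)

Let pos a := index a (enum M).
Let p := #|M|.

Lemma minN a b : a \in M -> x a b \in Γ = false.
Proof. by move=> /minimalP/(_ b)/negPf. Qed.

Lemma pos_lt a : (pos a < p) = (a \in M).
Proof. by rewrite /p cardE index_mem mem_enum. Qed.

Lemma pos_notin a : a \notin M -> pos a = p.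
Proof. by move=> aM; apply/eqP; rewrite /p cardE /pos memNindex // mem_enum. Qed.

Lemma pos_inj a b : a \in M -> pos a = pos b -> a = b.
Proof.
move=> aM e; have bM : b \in M by rewrite -pos_lt -e pos_lt.
by rewrite -(nth_index a (s := enum M) (x := a)) ?mem_enum // -/(pos a) e
  nth_index ?mem_enum.
Qed.

Lemma pos_onto m : m < p -> exists2 a, a \in M & pos a = m.
Proof.
rewrite /p cardE => mp; have [a0 _] : exists a0 : 'I_n, True.
  by case E : (enum M) mp => [|a0 e] // _; exists a0.
exists (nth a0 (enum M) m); first by rewrite -mem_enum mem_nth.
by rewrite /pos index_uniq // enum_uniq.
Qed.

Definition rank (v : gvar n) := maxn (pos v.1) (pos v.2).

Lemma rank_x a b : rank (x a b).1 = maxn (pos a) (pos b).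
Proof. by rewrite /rank /x; case: ifP => //= _; rewrite maxnC. Qed.

(** Going down to level [m] adds pivots of rank [m] only, which yields regularity. A non-minimal
    element has position [p], so its unset variables belong to every level up to [p]. *)
Definition U m : {set gvar n} := [set v | (v \notin clause_vars Γ) && (m <= rank v)].

Lemma x_U m a b : a != b -> ((x a b).1 \in U m) =
  [&& x a b \notin Γ, x b a \notin Γ & m <= maxn (pos a) (pos b)].
Proof. by move=> ab; rewrite inE mem_clause_vars neg_x // negb_or rank_x andbA. Qed.

Lemma U_sub m m' : m <= m' -> U m' \subset U m.
Proof.
by move=> mm; apply/subsetP=> v; rewrite !inE => /andP[-> /(leq_trans mm)].
Qed.

(* D_{a,m} and Q_{a,c} of the header, up to literals of Γ; the [_gam] fields
   record the literals of Γ that must not get lost. *)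
Record some_below a m C : Prop := SomeBelow {
  sb_low : forall j, pos j < m -> j != a -> x j a \in C;
  sb_gam : forall c k, c \in M -> (c == a) || (m <= pos c) -> x k c \in Γ -> x k c \in C;
  sb_upp : forall l, l \in C ->
    l \in Γ \/ exists j, [/\ pos j < m, j != a & l = x j a] }.

Record below_or a c C : Prop := BelowOr {
  bo_mid : x a c \in C;
  bo_low : forall j, pos j < pos c -> j != a -> x j a \in C;
  bo_gam : forall c' k, c' \in M -> pos c <= pos c' -> x k c' \in Γ -> x k c' \in C;
  bo_upp : forall l, l \in C ->
    [\/ l \in Γ, l = x a c | exists j, [/\ pos j < pos c, j != a & l = x j a]] }.

Lemma x_inj a b c d : x a b = x c d -> a = c /\ b = d.
Proof. by move/eqP; rewrite x_eqE => /andP[/eqP-> /eqP->]. Qed.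

Lemma mem_bigcup_seqP (K : seq 'I_n) (B : 'I_n -> clause (gvar n)) l :
  reflect (exists2 k, k \in K & l \in B k) (l \in \bigcup_(k <- K) B k).
Proof.
elim: K => [|k K IH]; rewrite ?big_nil ?big_cons ?inE.
  by constructor; case.
apply: (iffP orP) => [[lk|/IH[k' kK lk]]|[k']].
- by exists k; rewrite ?mem_head.
- by exists k'; rewrite // inE kK orbT.
- by rewrite inE => /orP[/eqP-> ?|? ?]; [left|right; apply/IH; exists k'].
Qed.

Definition base_bound := 2 * n + 1.

(** Starting from [has_pred a], each [x k a] outside Γ with [k] non-minimal is resolved away: for a
    minimal [J k] below [k], the clause T_{J k,k,a} replaces it by [x (J k) a] and a literal of
    Γ. *)
Lemma some_below_top (L' : {set clause (gvar n)}) a : L \subset L' -> a \in M ->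
  exists2 C, some_below a p C & der F true L' (U p) C L' base_bound.
Proof.
move=> LL aM.
pose K := enum [set k | (k \notin M) && (x k a \notin Γ)].
pose J k := odflt a [pick j in M | x k j \in Γ].
have memK k : (k \in K) = (k \notin M) && (x k a \notin Γ).
  by rewrite mem_enum inE.
have JP k : k \in K -> [/\ k \notin M, x k a \notin Γ, J k \in M,
    x k (J k) \in Γ & uniq [:: J k; k; a]].
  rewrite memK => /andP[kM ka].
  have [JM Jk] : J k \in M /\ x k (J k) \in Γ.
    rewrite /J; case: pickP => [j /andP[]//|none]; have [j jM kj] := above kM.
    by have := none j; rewrite jM kj.
  have kJ : J k != k by apply: contraNneq kM => <-.
  have ka' : k != a by apply: contraNneq kM => ->.
  have aJ : J k != a by apply: contraNneq ka => <-.
  by split=> //=; rewrite !inE negb_or kJ aJ ka'.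
pose A k := available_clause r s L Γ (J k) k a.
have AP k : k \in K -> {subset A k <= T3 (J k) k a :|: Γ}.
  move=> kK; have [kM ka JM kJ u] := JP k kK.
  by apply/subsetP/available_sub/avail; rewrite // kJ orbT.
have TA k l : k \in K -> l \in T3 (J k) k a -> l \in A k.
  by move=> kK; apply/subsetP/T3_available.
have d0 : der F true L' set0 (has_pred a) L' 1.
  by apply: der_leaf; rewrite inE has_pred_GGT.
have Apred k j : (x k j \in has_pred a) = (j == a) && (k != a).
  apply/imsetP/andP=> [[i]|[/eqP-> ka]]; last by exists k; rewrite ?inE.
  by rewrite inE => ia /x_inj[-> ->]; rewrite ia eqxx.
have Kna k : k \in K -> k != a.
  by rewrite memK => /andP[kM _]; apply: contraNneq kM => ->.
have := der_chain (K := K) (y := fun k => x k a) (A := A) d0.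
case.
- rewrite map_inj_in_uniq ?enum_uniq // => i j iK jK e.
  have : (x j a).1 \in clause_vars [set x i a].
    by rewrite -e; apply/imsetP; exists (x i a); rewrite ?inE.
  rewrite mem_clause_vars !inE neg_x ?Kna // !x_eqE eqxx andbT.
  by case/orP=> [/eqP//|/andP[_ /eqP e2]]; case/eqP: (Kna j jK).
- move=> k kK; rewrite inE neg_x ?Kna // !Apred eqxx Kna //.
  by split=> //; rewrite (negPf (Kna _ kK)).
- move=> k kK; have [kM ka JM kJ u] := JP k kK; rewrite neg_x ?Kna //.
  split; first exact: available_clause_in.
    by rewrite TA // mem_T3 // !x_eqE !eqxx orbT.
  apply/negP=> /(AP _ kK); rewrite in_setU mem_T3 // !x_eqE.
  by move: u; rewrite uniq3 => u h; x_contra.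
- move=> i j iK jK ij; have [jM ja JM jJ u] := JP j jK; rewrite neg_x ?Kna //.
  have [iM ia _ _ _] := JP i iK; move: u; rewrite uniq3 => u.
  have aiΓ := minN i aM.
  apply/andP; split; apply/negP=> /(AP _ jK).
    by rewrite in_setU mem_T3 ?uniq3 // !x_eqE => h; x_contra.
  by rewrite in_setU mem_T3 ?uniq3 // !x_eqE => h; x_contra.
set C := (_ :|: _) => t tP; exists C; last first.
  apply: der_weaken (ex_intro _ t tP) => //.
    rewrite set0U; apply/subsetP=> v; rewrite inE => /mapP[k kK ->].
    have [kM ka JM kJ u] := JP k kK.
    by rewrite x_U ?Kna // ka minN // (pos_notin kM) leq_maxl.
  rewrite /base_bound addnC leq_add2r leq_mul2l /=.
  by rewrite -cardE -[leqRHS]card_ord max_card.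
split.
- move=> j; rewrite pos_lt => jM ja; rewrite !inE Apred eqxx ja /= andbT.
  apply/orP; left; apply/mapP=> [[k /JP[kM _ _ _ _] /x_inj[e _]]].
  by rewrite -e jM in kM.
- move=> c k cM; rewrite leqNgt pos_lt cM orbF => /eqP-> kaΓ.
  rewrite !inE Apred eqxx /=; apply/orP; left; apply/andP; split.
    by apply/mapP=> [[j /JP[_ jaΓ _ _ _] /x_inj[e _]]]; rewrite -e kaΓ in jaΓ.
  by apply: contraTneq kaΓ => ->; rewrite minN.
- move=> l; rewrite in_setU => /orP[|/mem_bigcup_seqP[k kK]].
    rewrite in_setD => /andP[lK /imsetP[j]]; rewrite inE => ja lE.
    have [jM|jM] := boolP (j \in M).
      by right; exists j; rewrite pos_lt.
    left; apply: contraNT lK => jaΓ; rewrite inE lE; apply: map_f.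
    by rewrite memK jM -lE.
  have [kM ka JM kJ u] := JP k kK; rewrite neg_x ?Kna // in_setD1.
  case/andP=> lak /(AP _ kK); rewrite in_setU mem_T3 // (negPf lak) /=.
  case/orP=> [/orP[/eqP->|/eqP->]|->]; [by left| |by left].
  by right; exists (J k); rewrite pos_lt JM; split=> //; move: u; rewrite uniq3 => /and3P[].
Qed.

(** For [j] other than [a], the clause T_{j,c,a} turns the literal [x j c] of [C0] into [x a c] and
    [x j a]. The pivots avoid the variable of [x c a], which is reserved for the next resolution. *)
Lemma below_or_chain (b : bool) (L1 L2 : {set clause (gvar n)}) a c C0 (k : nat) :
  a \in M -> c \in M -> pos a < pos c -> L \subset L2 ->
  some_below c (pos c).+1 C0 -> der F b L1 (U (pos c).+1) C0 L2 k ->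
  exists2 C, below_or a c C &
    der F b L1 (U (pos c) :\ (x c a).1) C L2 (k + 2 * n).
Proof.
move=> aM cM ac LL [low gam upp] d0.
have neq_ac : a != c by apply: contraTneq ac => ->; rewrite ltnn.
pose K := enum [set j | (pos j < pos c) && (j != a)].
have KP j : j \in K -> [/\ pos j < pos c, j \in M & uniq [:: j; c; a]].
  rewrite mem_enum inE => /andP[jc ja].
  have jM : j \in M by rewrite -pos_lt (ltn_trans jc) // pos_lt.
  split=> //; rewrite uniq3 ja (eq_sym c) neq_ac !andbT.
  by apply: contraTneq jc => ->; rewrite ltnn.
have Knc j : j \in K -> j != c by case/KP=> _ _; rewrite uniq3 => /and3P[].
pose A j := available_clause r s L Γ j c a.
have AP j : j \in K -> {subset A j <= T3 j c a :|: Γ}.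
  move=> jK; have [jc jM u] := KP j jK.
  by apply/subsetP/available_sub/avail; rewrite // ?cM // minN.
have TA j l : j \in K -> l \in T3 j c a -> l \in A j.
  by move=> jK; apply/subsetP/T3_available.
have := der_chain (K := K) (y := fun j => x j c) (A := A) d0.
case.
- rewrite map_inj_in_uniq ?enum_uniq // => i j iK jK e.
  have : (x j c).1 \in clause_vars [set x i c].
    by rewrite -e; apply/imsetP; exists (x i c); rewrite ?inE.
  rewrite mem_clause_vars !inE neg_x ?Knc // !x_eqE eqxx andbT.
  by case/orP=> [/eqP//|/andP[_ /eqP e2]]; case/eqP: (Knc j jK).
- move=> j jK; have [jc jM u] := KP j jK; rewrite neg_x ?Knc //; split.
  + rewrite x_U ?Knc // !minN //=.
    by rewrite -leqNgt geq_max leqnn ltnW.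
  + by apply: low; rewrite ?Knc // ltnW.
  + apply/negP=> /upp[|[i [_ _ /x_inj[_ e]]]]; first by rewrite minN.
    by move: (Knc j jK); rewrite e eqxx.
- move=> j jK; have [jc jM u] := KP j jK; rewrite neg_x ?Knc //.
  split; first exact: available_clause_in.
    by rewrite TA // mem_T3 // !x_eqE !eqxx.
  apply/negP=> /(AP _ jK); rewrite in_setU minN // mem_T3 // !x_eqE.
  by move: u; rewrite uniq3 => u h; x_contra.
- move=> i j iK jK ij; have [jc jM u] := KP j jK; rewrite neg_x ?Knc //.
  have [ic iM u'] := KP i iK; move: u u'; rewrite !uniq3 => u u'.
  apply/andP; split; apply/negP=> /(AP _ jK).
    by rewrite in_setU mem_T3 ?uniq3 // !x_eqE minN // => h; x_contra.
  by rewrite in_setU mem_T3 ?uniq3 // !x_eqE minN // => h; x_contra.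
set C := (_ :|: _) => t tP; exists C; last first.
  apply: der_weaken (ex_intro _ t tP); first by case: b {d0 tP}.
    apply/subsetP=> v; rewrite in_setU => /orP[vU|].
      rewrite in_setD1 (subsetP (U_sub (leqnSn _)) _ vU) andbT.
      apply: contraTneq vU => ->; rewrite x_U 1?eq_sym // !minN //=.
      by rewrite -leqNgt geq_max leqnn ltnW.
    rewrite inE => /mapP[j jK ->]; have [jc jM u] := KP j jK.
    rewrite in_setD1 x_U ?Knc // !minN //= leq_maxr andbT.
    apply: contraNneq (Knc j jK) => e.
    have : (x j c).1 \in clause_vars [set x c a].
      by rewrite e; apply/imsetP; exists (x c a); rewrite ?inE.
    rewrite mem_clause_vars !inE neg_x ?Knc // !x_eqE eqxx /=.
    by move: u; rewrite uniq3 => u h; apply/eqP; x_contra.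
  rewrite leq_add2l leq_mul2l /= -cardE -[leqRHS]card_ord.
  exact: max_card.
have KC l : l \in C0 -> (forall j, j \in K -> l != x j c) -> l \in C.
  move=> lC lK; rewrite in_setU in_setD lC andbT; apply/orP; left.
  by rewrite inE; apply/mapP=> [[j jK e]]; move: (lK j jK); rewrite e eqxx.
split.
- apply: KC; first by apply: low; rewrite // ltnW.
  by move=> j; rewrite mem_enum inE x_eqE eqxx andbT eq_sym => /andP[].
- move=> j jc ja; have jK : j \in K by rewrite mem_enum inE jc.
  rewrite in_setU; apply/orP; right; apply/mem_bigcup_seqP; exists j => //.
  have [_ jM u] := KP j jK.
  rewrite neg_x ?Knc // in_setD1 x_eqE (negPf (Knc j jK)) /=.
  by rewrite TA // mem_T3 // !x_eqE !eqxx !orbT.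
- move=> c' i c'M cc' iΓ; apply: KC.
    apply: gam => //; move: cc'; rewrite leq_eqVlt => /orP[/eqP cc'|->].
      by rewrite (pos_inj cM cc') eqxx.
    by rewrite orbT.
  move=> j /KP[_ jM _]; rewrite x_eqE; apply/nandP; left.
  by apply: contraTneq iΓ => ->; rewrite minN.
- move=> l; rewrite in_setU => /orP[|/mem_bigcup_seqP[j jK]].
    rewrite in_setD => /andP[lK /upp[|[j [jc nj e]]]]; first by constructor 1.
    have [ja|ja] := eqVneq j a; first by constructor 2; rewrite e ja.
    case/negP: lK; rewrite inE e; apply: map_f; rewrite mem_enum inE ja andbT.
    rewrite ltn_neqAle -ltnS jc andbT; apply: contra nj => /eqP/esym e'.
    by rewrite (pos_inj cM e').
  rewrite neg_x ?Knc // in_setD1 => /andP[lcj /(AP _ jK)].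
  have [jc jM u] := KP j jK.
  rewrite in_setU mem_T3 // (negPf lcj) /=.
  case/orP=> [/orP[/eqP->|/eqP->]|->]; [by constructor 2| |by constructor 1].
  constructor 3; exists j; split=> //; move: u; by rewrite uniq3 => /and3P[].
Qed.

Lemma some_below_resolve a c C1 C2 :
  a \in M -> c \in M -> pos a < pos c ->
  some_below a (pos c).+1 C1 -> below_or a c C2 ->
  exists2 C, resolvent (x c a) C1 C2 C & some_below a (pos c) C.
Proof.
move=> aM cM ac [low gam upp] [mid low2 gam2 upp2].
have ca : c != a by apply: contraTneq ac => ->; rewrite ltnn.
exists ((C1 :\ x c a) :|: (C2 :\ neg (x c a))); rewrite ?neg_x //.
  rewrite -(neg_x ca); apply: resolventI; rewrite ?neg_x //.
  - exact: low.
  - apply/negP=> /upp[|[j [_ _ /x_inj[_ e]]]]; first by rewrite minN.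
    by rewrite e eqxx in ca.
  - apply/negP=> /upp2[|/x_inj[e _]|[j [jc _ /x_inj[e _]]]].
    + by rewrite minN.
    + by rewrite e eqxx in ca.
    + by rewrite e ltnn in jc.
split.
- move=> j jc ja; rewrite in_setU in_setD1 x_eqE eqxx andbT low ?andbT // 1?ltnW //.
  by apply/orP; left; apply: contraTneq jc => ->; rewrite ltnn.
- move=> d k dM; rewrite leq_eqVlt orbA orbAC => hd kd.
  case/orP: hd => [hd|/eqP hd].
    rewrite in_setU !in_setD1 !x_eqE (gam d k) // andbT; apply/orP; left.
    by apply/nandP; left; apply: contraTneq kd => ->; rewrite minN.
  (* Here [d] is [c], about which [C1] guarantees nothing; the literal comes from [C2]. *)
  rewrite in_setU !in_setD1 !x_eqE (gam2 d k) ?hd // andbT; apply/orP; right.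
  by apply/nandP; left; apply: contraTneq kd => ->; rewrite minN.
- move=> l; rewrite in_setU !in_setD1 => /orP[/andP[lca /upp[|[j [jc ja e]]]]|].
  + by left.
  + right; exists j; split=> //; rewrite ltn_neqAle -ltnS jc andbT.
    apply: contra lca => /eqP/esym e'; by rewrite e (pos_inj cM e').
  + case/andP=> lac /upp2[|e|[j [jc ja e]]]; first by left.
      by rewrite e eqxx in lac.
    by right; exists j.
Qed.

(** * Descending the levels with learned clauses *)

Definition below_or_known (L' : {set clause (gvar n)}) a m :=
  forall c, c \in M -> m <= pos c -> exists2 C, below_or a c C & C \in L'.

Lemma below_or_known_mono (L1 L2 : {set clause (gvar n)}) a m :
  L1 \subset L2 -> below_or_known L1 a m -> below_or_known L2 a m.
Proof.
move=> sub known c cM mc; have [C HC CL] := known c cM mc.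
by exists C; rewrite ?(subsetP sub).
Qed.

Lemma U_step a c : a \in M -> c \in M -> pos a < pos c ->
  U (pos c).+1 \subset U (pos c) :\ (x c a).1
  /\ (x c a).1 |: (U (pos c) :\ (x c a).1) \subset U (pos c).
Proof.
move=> aM cM ac; have ca : c != a by apply: contraTneq ac => ->; rewrite ltnn.
split.
  apply/subsetP=> v vU; rewrite in_setD1 (subsetP (U_sub (leqnSn _)) _ vU) andbT.
  apply: contraTneq vU => ->; rewrite x_U // !minN //=.
  by rewrite -leqNgt geq_max leqnn ltnW.
rewrite subUset subD1set sub1set x_U // !minN //=.
by rewrite leq_maxl.
Qed.

(** The known Q_{a,c} serve as leaf premises, so each level below [p] costs a leaf and an inference
    and the derivation stays input. *)
Lemma some_below_input (L' : {set clause (gvar n)}) a (d m : nat) :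
  L \subset L' -> a \in M -> below_or_known L' a (pos a).+1 ->
  m + d = p -> pos a < m ->
  exists2 C, some_below a m C & der F true L' (U m) C L' (base_bound + 2 * d).
Proof.
move=> LL aM known; elim: d m => [|d IH] m.
  by rewrite addn0 => -> _; rewrite muln0 addn0; apply: some_below_top.
rewrite addnS -addSn => mp am.
have [C1 b1 d1] := IH m.+1 mp (leqW am).
have [c cM cm] := pos_onto (leq_trans (leq_addr d m.+1) (eq_leq mp)).
subst m; have [C2 b2 C2L] := known c cM am.
have [C res bC] := some_below_resolve aM cM am b1 b2.
exists C => //; have [s1 s2] := U_step aM cM am.
have := der_resolve_leaf (der_weaken _ s1 (leqnn _) d1) _ _ res.
move=> /(_ true isT); rewrite in_setU C2L orbT in_setD1 eqxx => /(_ isT isT) d2.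
by apply: der_weaken d2; rewrite // mulnS addnA addnAC.
Qed.

Definition learn_bound := base_bound + n * (base_bound + 4 * n + 1).

(** The lemmas known for [c] give D_{c,m+1} an input derivation; prolonged by [below_or_chain] it
    still is one, so Q_{a,c} is learned in turn. *)
Lemma some_below_learn (L' : {set clause (gvar n)}) a (d m : nat) :
  L \subset L' -> a \in M ->
  (forall c, c \in M -> pos a < pos c -> below_or_known L' c (pos c).+1) ->
  m + d = p -> pos a < m ->
  exists C L'', [/\ some_below a m C, below_or_known L'' a m
    & der F false L' (U m) C L'' (base_bound + d * (base_bound + 4 * n + 1))].
Proof.
move=> LL aM known; elim: d m => [|d IH] m.
  rewrite addn0 => -> _; have [C bC dC] := some_below_top LL aM.
  exists C, L'; split=> //; last by rewrite mul0n addn0; apply: der_weaken dC.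
  by move=> c cM; rewrite leqNgt pos_lt cM.
rewrite addnS -addSn => mp am.
have [C1 [L1 [b1 known1 d1]]] := IH m.+1 mp (leqW am).
have LL1 := der_mono d1; have LL1' := subset_trans LL LL1.
have [c cM cm] := pos_onto (leq_trans (leq_addr d m.+1) (eq_leq mp)).
subst m; have knownc := below_or_known_mono LL1 (known c cM am).
have [C0 b0 d0] := some_below_input LL1' cM knownc mp (ltnSn _).
have [C2 b2 /der_learn d2] := below_or_chain aM cM am LL1' b0 d0.
have [C res bC] := some_below_resolve aM cM am b1 b2.
exists C, (C2 |: L1); split=> //.
  move=> c' c'M; rewrite leq_eqVlt => /orP[/eqP/(pos_inj cM)<-|cc'].
    by exists C2; rewrite // setU11.
  have [C' bC' C'L] := known1 c' c'M cc'.
  by exists C'; rewrite // setU1r.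
have [s1 s2] := U_step aM cM am.
have := der_resolve (der_weaken _ s1 (leqnn _) d1) d2 _ res.
move=> /(_ false isT); rewrite in_setD1 eqxx => /(_ isT) d3.
apply: der_weaken d3; rewrite //.
(* Rederiving D_{c,m+1} costs [base_bound + 2 * d] and the chain [2 * n]; with [d <= n] this gives
   the term [4 * n]. *)
have dn : d <= n.
  rewrite -[n]card_ord (leq_trans _ (max_card (mem M))) // -/p -mp.
  exact: leq_addl.
rewrite mulSn; clear -dn; lia.
Qed.

(** The elements [c] are treated from the last to the first. When [c] has its turn, the lemmas of
    all later elements are known, as [some_below_learn] requires, and those of [c] are added. *)
Lemma some_below_root a (d m : nat) :
  a \in M -> pos a = 0 -> m + d = p -> 0 < m ->
  exists C L', [/\ some_below a m C,
    forall c, c \in M -> m <= pos c -> below_or_known L' c (pos c).+1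
    & der F false L (U m) C L' (base_bound + d * (learn_bound + 2 * n + 1))].
Proof.
move=> aM a0; elim: d m => [|d IH] m.
  rewrite addn0 => -> _; have [C bC dC] := some_below_top (subxx L) aM.
  exists C, L; split=> //; last by rewrite mul0n addn0; apply: der_weaken dC.
  by move=> c cM; rewrite leqNgt pos_lt cM.
rewrite addnS -addSn => mp am.
have [C1 [L1 [b1 known1 d1]]] := IH m.+1 mp (leqW am).
have LL1 := der_mono d1.
have [c cM cm] := pos_onto (leq_trans (leq_addr d m.+1) (eq_leq mp)).
subst m; rewrite -a0 in am.
have [C0 [L2 [b0 known2 d0]]] := some_below_learn LL1 cM known1 mp (ltnSn _).
have L12 := der_mono d0; have LL2 := subset_trans LL1 L12.
have [C2 b2 d2] := below_or_chain aM cM am LL2 b0 d0.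
have [C res bC] := some_below_resolve aM cM am b1 b2.
exists C, L2; split=> //.
  move=> c' c'M; rewrite leq_eqVlt => /orP[/eqP/(pos_inj cM)<- //|cc'].
  by apply: below_or_known_mono L12 _; apply: known1.
have [s1 s2] := U_step aM cM am.
have := der_resolve (der_weaken _ s1 (leqnn _) d1) d2 _ res.
move=> /(_ false isT); rewrite in_setD1 eqxx => /(_ isT) d3.
apply: der_weaken d3; rewrite //.
have dn : d <= n.
  rewrite -[n]card_ord (leq_trans _ (max_card (mem M))) // -/p -mp.
  exact: leq_addl.
rewrite mulSn /learn_bound; clear -dn; nia.
Qed.

Definition elimination_bound := base_bound + n * (learn_bound + 2 * n + 1).

(** At level 1, with [a] number 0, no literal outside Γ remains, since the only candidate is
    [x a a]. As [a] and the positions from 1 on exhaust the minimal elements, all of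
    [from_minimal Γ] is kept. *)
Lemma elimination a0 : a0 \in M -> exists C L',
  [/\ from_minimal Γ \subset C, C \subset Γ &
   der F false L (~: clause_vars Γ) C L' elimination_bound].
Proof.
move=> a0M; have p0 : 0 < p by rewrite /p (cardD1 a0) a0M.
have [a aM pa] := pos_onto p0.
have [C [L' [[low gam upp] _ dC]]] := some_below_root aM pa (subnKC p0) isT.
exists C, L'; split.
- apply/subsetP=> l; rewrite inE => /andP[lΓ /existsP[c /andP[cM /existsP[k /eqP lE]]]].
  rewrite lE in lΓ *; apply: gam => //.
  case: (posnP (pos c)) => [c0|_]; last by rewrite orbT.
  by rewrite (pos_inj cM (etrans c0 (esym pa))) eqxx.
- apply/subsetP=> l /upp[//|[j [j0 ja]]].
  move: j0; rewrite ltnS leqn0 => /eqP j0.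
  by rewrite (pos_inj aM (etrans pa (esym j0))) eqxx in ja.
- apply: der_weaken dC => //.
    by apply/subsetP=> v; rewrite !inE => /andP[].
  rewrite leq_add2l leq_mul2r; apply/orP; right.
  rewrite -[n]card_ord (leq_trans (leq_subr _ _)) //; exact: max_card.
Qed.

End Elimination.

(** * Learning the transitivity clauses *)

Section Search.

Variables (n : nat) (r s : 'I_n -> 'I_n -> 'I_n -> 'I_n).
Hypothesis guards_rs : guards r s.
Implicit Types (a b c d i j k : 'I_n) (C D E Γ Δ : clause (gvar n)).
Implicit Types (L : {set clause (gvar n)}).

Let F := GGT r s.

Definition goal L Γ E (L' : {set clause (gvar n)}) (m : nat) : Prop :=
  exists C, [/\ E \subset C, C \subset Γ & der F false L (~: clause_vars Γ) C L' m].

Definition unlearned L :=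
  #|[set t : 'I_n * 'I_n * 'I_n | T3 t.1.1 t.1.2 t.2 \notin L]|.

Definition unset Γ := #|~: clause_vars Γ|.

Lemma clause_vars1 (l : literal (gvar n)) Γ :
  clause_vars (l |: Γ) = l.1 |: clause_vars Γ.
Proof. exact: imsetU1. Qed.

Lemma unset_lt (l : literal (gvar n)) Γ :
  l.1 \notin clause_vars Γ -> unset (l |: Γ) < unset Γ.
Proof.
move=> lΓ; rewrite /unset clause_vars1; apply: proper_card.
rewrite setCU setIC -setDE properD1 // inE //.
Qed.

Lemma unset_le (l : literal (gvar n)) Γ : unset (l |: Γ) <= unset Γ.
Proof. by apply: subset_leq_card; rewrite setCS clause_vars1 subsetUr. Qed.

Lemma unset_max Γ : unset Γ <= n * n.
Proof.
by rewrite -[X in X * X]card_ord -card_prod max_card.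
Qed.

Lemma unset_x a b Γ : a != b ->
  ((x a b).1 \notin clause_vars Γ) = (x a b \notin Γ) && (x b a \notin Γ).
Proof. by move=> ab; rewrite mem_clause_vars neg_x // negb_or. Qed.

Lemma minimal1 a c d Γ :
  (a \in minimal (x c d |: Γ)) = (a != c) && (a \in minimal Γ).
Proof.
apply/minimalP/andP=> [h|[ac /minimalP h] b]; last first.
  by rewrite in_setU1 x_eqE negb_or negb_and ac h.
split; first by apply: contraTneq isT => e; have := h d; rewrite e setU11.
by apply/minimalP=> b; have := h b; rewrite in_setU1 negb_or => /andP[].
Qed.

(** The lower bounds [E1] and [E2] put the pivot into both premises, and the upper bounds exclude
    its complement from each. *)
Lemma branch L L1 L2 Γ E E1 E2 a b m1 m2 :
  a != b -> (x a b).1 \notin clause_vars Γ ->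
  goal L (x a b |: Γ) E1 L1 m1 -> x a b \in E1 ->
  goal L1 (x b a |: Γ) E2 L2 m2 -> x b a \in E2 ->
  E \subset (E1 :\ x a b) :|: (E2 :\ x b a) ->
  goal L Γ E L2 (m1 + m2 + 1).
Proof.
move=> ab; rewrite unset_x // => /andP[abΓ baΓ].
have ba_ab : x b a != x a b by rewrite x_eqE (negPf ab) andbF.
case=> C1 [EC1 CΓ1 d1] abE1 [C2 [EC2 CΓ2 d2]] baE2 sub.
exists ((C1 :\ x a b) :|: (C2 :\ x b a)); split.
- by apply: subset_trans sub _; rewrite setUSS ?setSD.
- by rewrite subUset !subDset CΓ1.
have vE : (x b a).1 = (x a b).1 by rewrite -(neg_x ab).
have C1ab : x b a \notin C1.
  by apply: contra baΓ => /(subsetP CΓ1); rewrite in_setU1 (negPf ba_ab).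
have C2ab : x a b \notin C2.
  by apply: contra abΓ => /(subsetP CΓ2); rewrite in_setU1 eq_sym (negPf ba_ab).
have res := resolventI (subsetP EC1 _ abE1) _ (B := C2).
rewrite (neg_x ab) in res.
have {}res := res C1ab (subsetP EC2 _ baE2) C2ab.
have UE : ~: clause_vars (x a b |: Γ) = ~: clause_vars Γ :\ (x a b).1.
  by rewrite clause_vars1 setCU setIC -setDE.
have UE' : ~: clause_vars (x b a |: Γ) = ~: clause_vars Γ :\ (x a b).1.
  by rewrite clause_vars1 vE setCU setIC -setDE.
rewrite UE in d1; rewrite UE' in d2.
have := der_resolve d1 d2 _ res; rewrite in_setD1 eqxx => /(_ isT).
rewrite setD1K // inE mem_clause_vars neg_x // negb_or abΓ //.
Qed.

Lemma goal_sub L Γ E E' (L' : {set clause (gvar n)}) m :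
  E' \subset E -> goal L Γ E L' m -> goal L Γ E' L' m.
Proof. by move=> sub [C [EC CΓ dC]]; exists C; rewrite (subset_trans sub EC). Qed.

Lemma goal_available L Γ a b c : uniq [:: a; b; c] -> T3 a b c \subset Γ ->
  available r s L Γ a b c -> goal L Γ (T3 a b c) L 1.
Proof.
move=> u TΓ /available_sub sub; exists (available_clause r s L Γ a b c); split.
- exact: T3_available.
- by apply: subset_trans sub _; rewrite subUset TΓ subxx.
- have := der_leaf false (available_clause_in r s Γ u (subxx L)).
  by apply: der_weaken; rewrite ?sub0set.
Qed.

(** The guard variable is unset in Γ, hence absent from [T3 a b c]; resolving the two initial
    clauses on it is an input derivation. *)
Lemma goal_learn L Γ a b c : uniq [:: a; b; c] -> T3 a b c \subset Γ ->
  ~~ available r s L Γ a b c -> goal L Γ (T3 a b c) (T3 a b c |: L) 4.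
Proof.
move=> u TΓ; rewrite negb_or => /andP[_ gΓ]; exists (T3 a b c); split=> //.
have [gF ngF] := andP (T3_GGT r s u).
have := gΓ; rewrite mem_clause_vars negb_or => /andP[g1 g2].
have {}g1 : guard r s a b c \notin T3 a b c by apply: contra g1; apply: subsetP.
have {}g2 : neg (guard r s a b c) \notin T3 a b c by apply: contra g2; apply: subsetP.
have nl (l : literal (gvar n)) : (neg l == l) = false.
  by case: l => v []; rewrite /neg /=; apply/eqP.
have d1 : der F true L set0 (guard r s a b c |: T3 a b c) L 1.
  by apply: der_leaf; rewrite in_setU gF.
have := der_resolve_leaf d1 _ _ (resolventI (setU11 _ _) _ (setU11 _ (T3 a b c)) _).
rewrite in_setU ngF in_set0 !in_setU1 negb_or nl g2 eq_sym negb_or nl g1.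
move=> /(_ isT isT isT isT); rewrite !setU1K // setUid => /der_learn.
by apply: der_weaken => //; rewrite setU0 sub1set inE.
Qed.

Lemma unlearned_lt L a b c :
  T3 a b c \notin L -> unlearned (T3 a b c |: L) < unlearned L.
Proof.
move=> TL; apply: proper_card; apply/properP; split.
  by apply/subsetP=> t; rewrite !inE negb_or => /andP[].
by exists (a, b, c); rewrite !inE //= eqxx.
Qed.

(** Some index of the guard lies outside [a], [b], [c], so adding literals of [T3 a b c] never sets
    the guard variable. *)
Lemma available_grow L Γ Δ a b c : uniq [:: a; b; c] ->
  Δ \subset T3 a b c :|: Γ ->
  available r s L Δ a b c -> available r s L Γ a b c.
Proof.
move=> u sub /orP[TL|]; first by rewrite /available TL.
have [rs nsub _ _] := guards_rs u; move: nsub; rewrite /available /guard.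
set i := r a b c in rs *; set j := s a b c in rs *.
move=> nsub; rewrite !mem_clause_vars neg_x //.
have nT k d : (x k d \in T3 a b c) -> [set k; d] \subset [set a; b; c].
  rewrite mem_T3 // !x_eqE subUset !sub1set !inE.
  by case/or3P=> /andP[/eqP-> /eqP->]; rewrite !eqxx ?orbT.
case/orP=> /(subsetP sub); rewrite in_setU => /orP[/nT|->]; rewrite ?orbT //.
  by rewrite (negPf nsub).
by rewrite setUC (negPf nsub).
Qed.

(** The invariant of the search: a minimal element is at most two steps below. The branchings of
    [search_learn] may lengthen a one-step chain to two steps, and [search_close] shortens it
    again. *)
Definition rooted Γ := forall k, k \notin minimal Γ ->
  exists2 a, a \in minimal Γ &
    x k a \in Γ \/ exists b, x b a \in Γ /\ x k b \in Γ.

Definition directly_rooted Γ := forall k, k \notin minimal Γ ->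
  exists2 a, a \in minimal Γ & x k a \in Γ.

Lemma rooted_extend Γ Δ a : directly_rooted Γ -> Γ \subset Δ -> a \in minimal Δ ->
  (forall k, k \in minimal Γ -> k \notin minimal Δ -> x k a \in Δ) ->
  rooted Δ.
Proof.
move=> root sub aΔ lost k kΔ; have [kΓ|kΓ] := boolP (k \in minimal Γ).
  by exists a => //; left; apply: lost.
have [b bΓ kb] := root k kΓ; have [bΔ|bΔ] := boolP (b \in minimal Δ).
  by exists b => //; left; apply: subsetP kb.
by exists a => //; right; exists b; rewrite (subsetP sub _ kb) lost.
Qed.

(** This bounds a search with learning discounted, as at most [n * n] variables are unset. The
    weight of a learned clause pays for three such searches and the nodes joining them. *)
Definition step_bound := elimination_bound n + 2 * (n * n).
Definition learn_weight := 3 * step_bound + 10.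

(** An amortised bound: learning a clause releases [learn_weight] nodes, and [2 * unset Γ] pays for
    the closing branchings, each of which sets a variable for a leaf and an inference. *)
Definition searchable L Γ := exists (L' : {set clause (gvar n)}) m,
  goal L Γ (from_minimal Γ) L' m /\
  m + learn_weight * unlearned L' <=
    learn_weight * unlearned L + elimination_bound n + 2 * unset Γ.

Lemma learn_weight_lt L1 L : unlearned L1 < unlearned L ->
  learn_weight * unlearned L1 + learn_weight <= learn_weight * unlearned L.
Proof. by rewrite -mulnSr leq_mul2l => ->; rewrite orbT. Qed.

Section Step.

Variables (L : {set clause (gvar n)}) (Γ : clause (gvar n)).
Hypothesis IH : forall L1 Δ, unset Δ < unset Γ -> rooted Δ -> searchable L1 Δ.

(** Branching on [a] and [k]: adding [x a k] falsifies T_{a,b,k}, while adding [x k a] leaves the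
    minimal elements as they are, [k] being non-minimal already. *)
Lemma search_close a b k : rooted Γ -> a \in minimal Γ -> k \notin minimal Γ ->
  x b a \in Γ -> x k b \in Γ -> x k a \notin Γ -> searchable L Γ.
Proof.
move=> root aM kM ba kb ka; have aN := minN _ aM.
have ab : a != b by apply: contraTneq ba => <-; rewrite aN.
have ak : a != k by apply: contraNneq kM => <-.
have bk : b != k by apply: contraNneq ka => <-.
have u : uniq [:: a; b; k] by rewrite uniq3 ab ak bk.
have akΓ : (x a k).1 \notin clause_vars Γ by rewrite unset_x // aN.
have kaΓ : (x k a).1 \notin clause_vars Γ by rewrite -(neg_x ak).
have minE c : (c \in minimal (x k a |: Γ)) = (c \in minimal Γ).
  rewrite minimal1; have [->|//] := eqVneq c k; by rewrite (negPf kM).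
have root' : rooted (x k a |: Γ).
  move=> d; rewrite minE => /root[c cM [dc|[e [ec de]]]]; exists c; rewrite ?minE //.
    by left; rewrite setU1r.
  by right; exists e; rewrite !setU1r.
have sub : from_minimal Γ \subset from_minimal (x k a |: Γ) :\ x k a.
  apply/subsetP=> l lM; rewrite in_setD1; move: (lM); rewrite inE.
  case/andP=> lΓ /existsP[c /andP[cM /existsP[d /eqP lE]]].
  apply/andP; split; first by apply: contraNneq ka => <-.
  by rewrite lE mem_from_minimal minE cM -lE setU1r.
have TΓ : T3 a b k \subset x a k |: Γ.
  apply/subsetP=> l; rewrite mem_T3 // in_setU1.
  by case/or3P=> /eqP->; rewrite ?ba ?kb ?eqxx ?orbT.
(* If the clause has to be learned here, all nodes but one are charged to [learn_weight]. *)
have [L1 [m1 [g1 le1]]] : exists (L1 : {set clause (gvar n)}) m,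
    goal L (x a k |: Γ) (T3 a b k) L1 m /\
    m + learn_weight * unlearned L1 <= learn_weight * unlearned L + 1.
  have [av|nav] := boolP (available r s L (x a k |: Γ) a b k).
    by exists L, 1; split; [exact: goal_available|rewrite addnC].
  exists (T3 a b k |: L), 4; split; first exact: goal_learn.
  have := nav; rewrite negb_or => /andP[/unlearned_lt/learn_weight_lt + _].
  by rewrite /learn_weight; clear; lia.
have [L2 [m2 [g2 le2]]] := IH L1 (unset_lt kaΓ) root'.
exists L2, (m1 + m2 + 1); split.
  apply: (branch ak akΓ g1 _ g2).
  - by rewrite mem_T3 // eqxx !orbT.
  - by rewrite mem_from_minimal setU11 minE.
  - by apply: subset_trans sub _; apply: subsetUr.
have := unset_lt kaΓ; move: le1 le2; clear.
move: (unlearned _) (unlearned L1) (unlearned L2) => v v1 v2.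
by move: (learn_weight * _) (learn_weight * _) (learn_weight * _) => ? ? ?; lia.
Qed.

(** Adding [x a c], [x c b] and, if missing, [x b a] falsifies T_{a,b,c}, which is learned there
    first; the opposite side of each branching is then searched. *)
Lemma search_learn a b c : directly_rooted Γ ->
  a \in minimal Γ -> c \in minimal Γ -> uniq [:: a; b; c] ->
  (b \in minimal Γ) || (x b a \in Γ) -> x b c \notin Γ ->
  ~~ available r s L Γ a b c -> searchable L Γ.
Proof.
move=> root aM cM u ab bc nav; have aN := minN _ aM; have cN := minN _ cM.
have := u; rewrite uniq3 => /and3P[nab nac nbc].
have [nba nca ncb] : [/\ b != a, c != a & c != b].
  by rewrite (eq_sym b) (eq_sym c) (eq_sym c).
pose Γ1 := x a c |: Γ; pose Γ2 := x c b |: Γ1.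
have acΓ : (x a c).1 \notin clause_vars Γ by rewrite unset_x // aN cN.
have caΓ : (x c a).1 \notin clause_vars Γ by rewrite -(neg_x nac).
have cbΓ : (x c b).1 \notin clause_vars Γ1.
  by rewrite unset_x // !in_setU1 !x_eqE cN (negPf bc) (negPf nba) (negPf nca).
have bcΓ : (x b c).1 \notin clause_vars Γ1 by rewrite -(neg_x ncb).
have lt1 := unset_lt acΓ.
have [L2 [m2 [g2 le2]]] : exists (L2 : {set clause (gvar n)}) m,
    goal L Γ2 [set x a c; x c b] L2 m /\
    m + learn_weight * unlearned L2 + learn_weight <=
      learn_weight * unlearned L + step_bound + 5.
  have TE : {subset [set x a c; x c b] <= T3 a b c}.
    by move=> l; rewrite in_set2 mem_T3 // => /orP[]->; rewrite ?orbT.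
  have T2 : T3 a b c \subset x b a |: Γ2.
    apply/subsetP=> l; rewrite mem_T3 // !in_setU1.
    by case/or3P=> ->; rewrite ?orbT.
  have sub : x b a |: Γ2 \subset T3 a b c :|: Γ.
    apply/subsetP=> l; rewrite [in X in _ -> X]in_setU mem_T3 // !in_setU1.
    by case/or4P=> ->; rewrite ?orbT.
  have nav2 : ~~ available r s L (x b a |: Γ2) a b c.
    by apply: contra nav; apply: available_grow.
  have gT := goal_learn u T2 nav2.
  have /learn_weight_lt leT : unlearned (T3 a b c |: L) < unlearned L.
    by apply: unlearned_lt; move: nav; rewrite negb_or => /andP[].
  have [ba|ba] := boolP (x b a \in Γ).
    exists (T3 a b c |: L), 4; split; last by move: leT; clear; lia.
    apply: goal_sub (_ : [set x a c; x c b] \subset T3 a b c) _; first exact/subsetP.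
    by move: gT; rewrite (setUidPr (_ : [set x b a] \subset Γ2)) // sub1set !setU1r.
  rewrite (negPf ba) orbF in ab; have bN := minN _ ab.
  have baΓ : (x b a).1 \notin clause_vars Γ2.
    by rewrite unset_x // !in_setU1 !x_eqE bN aN (negPf nba)
       (negPf nab) (negPf nac) (negPf nbc) /= ?andbF.
  have abΓ : (x a b).1 \notin clause_vars Γ2 by rewrite -(neg_x nba).
  (* On this side [b] stays minimal and lies below both elements that lose minimality, [a] and
     [c]. *)
  have bM : b \in minimal (x a b |: Γ2) by rewrite !minimal1 nba nbc.
  have [||L2 [m2 [g2 le2]]] := IH (T3 a b c |: L) (Δ := x a b |: Γ2).
  - apply: leq_ltn_trans (unset_le _ _) _.
    exact: leq_ltn_trans (unset_le _ _) lt1.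
  - apply: rooted_extend root _ bM _.
      by apply/subsetP=> l lΓ; rewrite !setU1r.
    move=> k kM; rewrite !minimal1 kM andbT.
    rewrite !negb_and !negbK; case/or3P=> /eqP->.
    + by rewrite setU11.
    + by rewrite setU1r // setU11.
    + by rewrite setU11.
  exists L2, (4 + m2 + 1); split.
    apply: (branch nba baΓ gT _ g2).
    - by rewrite mem_T3 // eqxx.
    - by rewrite mem_from_minimal setU11.
    apply/subsetP=> l lE; rewrite in_setU in_setD1 (TE _ lE) andbT; apply/orP; left.
    move: lE; rewrite !inE => /orP[] /eqP->; rewrite x_eqE.
      by rewrite (negPf nab).
    by rewrite (negPf ncb).
  have := unset_max (x a b |: Γ2); move: le2 leT; rewrite /step_bound; clear.
  move: (unlearned _) (unlearned _) (unlearned L2) => v v1 v2.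
  by move: (learn_weight * _) (learn_weight * _) (learn_weight * _) => ? ? ?; lia.
have cM' : c \in minimal (x b c |: Γ1) by rewrite !minimal1 ncb nca.
have aM' : a \in minimal (x c a |: Γ) by rewrite minimal1 nac.
have [||L3 [m3 [g3 le3]]] := IH L2 (Δ := x b c |: Γ1).
- exact: leq_ltn_trans (unset_le _ _) lt1.
- apply: rooted_extend root _ cM' _.
    by apply/subsetP=> l lΓ; rewrite !setU1r.
  move=> k kM; rewrite !minimal1 kM andbT negb_and !negbK.
  by case/orP=> /eqP->; rewrite ?setU11 // setU1r // setU11.
have [||L4 [m4 [g4 le4]]] := IH L3 (Δ := x c a |: Γ).
- exact: unset_lt.
- apply: rooted_extend root (subsetUr _ _) aM' _.
  by move=> k kM; rewrite minimal1 kM andbT negbK => /eqP->; rewrite setU11.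
have g23 : goal L Γ1 (x a c |: from_minimal (x b c |: Γ1) :\ x b c) L3 (m2 + m3 + 1).
  apply: (branch ncb cbΓ g2 _ g3).
  - by rewrite !inE eqxx orbT.
  - by rewrite mem_from_minimal setU11.
  rewrite subUset subsetUr andbT sub1set !inE x_eqE (negPf nac) eqxx //=.
exists L4, (m2 + m3 + 1 + m4 + 1); split.
  apply: (branch nac acΓ g23 _ g4).
  - by rewrite setU11.
  - by rewrite mem_from_minimal setU11.
  apply/subsetP=> l; rewrite inE => /andP[lΓ /existsP[d /andP[dM /existsP[k /eqP lE]]]].
  rewrite lE in lΓ *; rewrite in_setU !in_setD1 in_setU1 in_setD1 !mem_from_minimal !minimal1.
  rewrite dM !in_setU1 lΓ !orbT !andbT /=.
  (* Only [c] loses minimality under [x c a], so a literal above another minimal element survives on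
     that side; [c] itself is still minimal under [x b c |: Γ1]. *)
  have [dc|dc] := eqVneq d c; last first.
    apply/orP; right; rewrite x_eqE /= ?andbT; apply/nandP; left.
    by apply: contraTneq lΓ => ->; rewrite cN.
  rewrite dc ncb nca !andbT; apply/orP; left; rewrite !x_eqE eqxx !andbT.
  have ka : k != a by apply: contraTneq lΓ => ->; rewrite aN.
  have kb : k != b by apply: contraTneq lΓ => ->; rewrite dc.
  by rewrite ka kb orbT.
have := unset_max (x b c |: Γ1); have := unset_max (x c a |: Γ).
move: le2 le3 le4; rewrite {2}/learn_weight /step_bound; clear.
move: (unlearned _) (unlearned L2) (unlearned L3) (unlearned L4) => v v2 v3 v4.
by move: (learn_weight * _) (learn_weight * _) (learn_weight * _) (learn_weight * _) => ? ? ? ?; lia.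
Qed.

End Step.

(** Induction on the number of unset variables. Two-step chains are closed first, so that learning
    and elimination start from a directly rooted Γ. *)
Lemma search L Γ : 0 < n -> rooted Γ -> searchable L Γ.
Proof.
move=> n0; have [u] := ubnP (unset Γ); elim: u L Γ => // u IHu L Γ uΓ root.
have IH L1 Δ : unset Δ < unset Γ -> rooted Δ -> searchable L1 Δ.
  by move=> uΔ; apply: IHu; apply: leq_trans uΔ _; rewrite -ltnS.
have [/existsP[k /andP[kM /existsPn none]]|/existsPn direct] :=
    boolP [exists k, (k \notin minimal Γ) &&
      ~~ [exists a, (a \in minimal Γ) && (x k a \in Γ)]].
  have {}none a : a \in minimal Γ -> x k a \notin Γ.
    by move=> aM; have := none a; rewrite aM.
  have [a aM [ka|[b [ba kb]]]] := root k kM; first by rewrite (negPf (none a aM)) in ka.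
  exact: (search_close L IH root aM kM ba kb (none a aM)).
have {}direct : directly_rooted Γ.
  move=> k kM; have := direct k; rewrite kM /= negbK.
  by case/existsP=> a /andP[aM ka]; exists a.
pose bad a b c := [&& a \in minimal Γ, c \in minimal Γ, uniq [:: a; b; c],
  (b \in minimal Γ) || (x b a \in Γ), x b c \notin Γ & ~~ available r s L Γ a b c].
have [/existsP[a /existsP[b /existsP[c]]]|/existsPn nobad] :=
    boolP [exists a, exists b, exists c, bad a b c].
  by case/and5P=> aM cM uabc ab /andP[bc nav]; apply: search_learn nav.
have [a0 a0M] : exists a, a \in minimal Γ.
  have [aM|/root[a aM _]] := boolP (Ordinal n0 \in minimal Γ); last by exists a.
  by exists (Ordinal n0).
have [|C [L' [EC CΓ dC]]] := elimination (r := r) (s := s) direct _ a0M (L := L).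
  move=> a b c aM cM uabc ab bc; apply: contraT => nav.
  have /existsPn/(_ b)/existsPn/(_ c) := nobad a.
  by rewrite /bad aM cM uabc ab bc nav.
exists L', (elimination_bound n); split; first by exists C.
rewrite -addnA addnCA leq_add2l.
have := der_mono dC => sub.
apply: leq_trans (leq_addr _ _); rewrite leq_mul2l; apply/orP; right.
by apply/subset_leq_card/subsetP=> t; rewrite !inE; apply/contra/subsetP.
Qed.

(** For the empty Γ all elements are minimal, so it is rooted, and a clause within Γ is empty. *)
Lemma refutation : 0 < n -> exists t : rtree (gvar n),
  regRTI_refutation F t /\
  num_clauses t <= learn_weight * (n * n * n) + elimination_bound n + 2 * (n * n).
Proof.
move=> n0; have root0 : rooted set0.
  by move=> k /minimalP[] b; rewrite inE.
have [L' [m [[C [_ C0 [t [v c _ _ /andP[tm _]]]]] le]]] := search set0 n0 root0.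
exists t; split; first by apply: valid_regRTI v _; rewrite c; apply/eqP; rewrite -subset0.
apply: leq_trans tm _; apply: leq_trans (leq_addr _ _) (leq_trans le _).
rewrite leq_add ?leq_mul2l ?unset_max // leq_add2r leq_mul2l; apply/orP; right.
by apply: leq_trans (max_card _) _; rewrite !card_prod !card_ord.
Qed.

End Search.

(** * The polynomial bound *)

Theorem theorem2 :
  exists p : {poly nat},
    forall (n : nat) (r s : 'I_n -> 'I_n -> 'I_n -> 'I_n),
      2 <= n -> guards r s ->
      exists t : rtree (gvar n),
        regRTI_refutation (GGT r s) t /\ num_clauses t <= (p.[n])%R.
Proof.
(* The cubic [learn_weight] is multiplied by the number of triples, whence degree 6; the estimates
   below give 67 + 17 + 2 = 86 as coefficient. *)
exists (100 *: 'X^6)%R => n r s n2 gr.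
have [t [ref le]] := refutation gr (ltnW n2).
exists t; split=> //; apply: leq_trans le _.
rewrite hornerZ hornerXn -[(n ^+ 6)%R]/(n * (n * (n * (n * (n * n))))).
rewrite -[(100 * _)%R]/(_ * _) natn.
(* The bound expands to 6n^3 + 6n^2 + 4n + 1, whose coefficients add up to 17. *)
have elim_le : elimination_bound n <= 17 * (n * n * n).
  rewrite /elimination_bound /learn_bound /base_bound; clear -n2; nia.
rewrite /learn_weight /step_bound.
move: (elimination_bound n) elim_le => e elim_le; clear -n2 elim_le.
have -> : n * (n * (n * (n * (n * n)))) = (n * n * n) * (n * n * n) by nia.
have [nn q0] : n * n <= n * n * n /\ 0 < n * n * n by split; nia.
move: (n * n) (n * n * n) elim_le nn q0 => m q eq mq q0.
have weight_le : 3 * (e + 2 * m) + 10 <= 67 * q by lia.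
by move: (leq_mul weight_le (leqnn q)) (leq_mul q0 (leqnn q)); lia.
Qed.
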